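(* Every right-continuous Hausdorff Baire topology on the bicyclic semigroup $\mathscr{C}(a,b)$ is discrete, and every left-continuous Hausdorff Baire topology on $\mathscr{C}(a,b)$ is discrete.
   Context: $\omega$ denotes the set of non-negative integers. The bicyclic monoid (bicyclic semigroup) $\mathscr{C}(a,b)$ is the semigroup with identity $1$ generated by two elements $a$ and $b$ subject only to the condition $ab=1$. Its elements are written uniquely as $b^ka^l$ with $k,l\in\omega$, and the operation is $$b^ka^l\cdot b^ma^n=\begin{cases} b^{k-l+m}a^n, & l<m;\\ b^ka^n, & l=m;\\ b^ka^{l-m+n}, & l>m.\end{cases}$$ A topology on a semigroup $S$ is right-continuous if for every $s\in S$ the map $S\to S$, $x\mapsto sx$ is continuous; it is left-continuous if for every $s\in S$ the map $S\to S$, $x\mapsto xs$ is continuous. A topological space $X$ is Baire if for each sequence $A_1,A_2,\ldots$ of dense open subsets of $X$ the intersection $\bigcap_{i=1}^\infty A_i$ is dense in $X$; a topology is Baire if the corresponding space is Baire. *)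

(* Defs.v *)
From HB Require Import structures.
From mathcomp Require Import all_boot zify.
From mathcomp Require Import all_classical topology.

Set Implicit Arguments.
Unset Strict Implicit.
Unset Printing Implicit Defensive.

Local Open Scope classical_set_scope.
Local Open Scope group_scope.

(* [Bicyclic k l] is the element b^k a^l of the bicyclic monoid, in normal
   form; see [bicyclicE] and [bicyclic_univ] for the presentation
   <a, b | a b = 1>. *)
Record bicyclic := Bicyclic { bexp : nat ; aexp : nat }.

Definition bicyclic_pair (x : bicyclic) := (bexp x, aexp x).
Definition pair_bicyclic (p : nat * nat) := Bicyclic p.1 p.2.

Lemma bicyclic_pairK : cancel bicyclic_pair pair_bicyclic.
Proof. by case. Qed.

HB.instance Definition _ := Choice.copy bicyclic (can_type bicyclic_pairK).

(* The exponent k - l + m of the case l < m is written k + (m - l), as k - l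
   is truncated in nat. *)
Definition bicyclic_mul (x y : bicyclic) : bicyclic :=
  let: Bicyclic k l := x in
  let: Bicyclic m n := y in
  if (l < m)%N then Bicyclic (k + (m - l)) n
  else if l == m then Bicyclic k n
  else Bicyclic k (l - m + n).

Lemma bicyclic_mulA : associative bicyclic_mul.
Proof.
move=> [k l] [m n] [p q]; rewrite /bicyclic_mul.
by repeat case: ifP => ?; congr Bicyclic; lia.
Qed.

Lemma bicyclic_mul1 : left_id (Bicyclic 0 0) bicyclic_mul.
Proof.
by move=> [m n]; rewrite /bicyclic_mul; repeat case: ifP => ?;
  congr Bicyclic; lia.
Qed.

Lemma bicyclic_mulr1 : right_id (Bicyclic 0 0) bicyclic_mul.
Proof.
by move=> [m n]; rewrite /bicyclic_mul; repeat case: ifP => ?;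
  congr Bicyclic; lia.
Qed.

HB.instance Definition _ :=
  isMonoid.Build bicyclic bicyclic_mulA bicyclic_mul1 bicyclic_mulr1.

Lemma bicyclicM k l m n : Bicyclic k l * Bicyclic m n =
  if (l < m)%N then Bicyclic (k + (m - l)) n
  else if l == m then Bicyclic k n
  else Bicyclic k (l - m + n).
Proof. by []. Qed.

Definition bicyclic_a := Bicyclic 0 1.
Definition bicyclic_b := Bicyclic 1 0.

Lemma bicyclic_ab : bicyclic_a * bicyclic_b = 1.
Proof. by []. Qed.

Lemma bicyclic_aX l : bicyclic_a ^+ l = Bicyclic 0 l.
Proof.
elim: l => // l IHl; rewrite expgSr IHl; case: l {IHl} => //= l.
by congr Bicyclic; lia.
Qed.

Lemma bicyclic_bX k : bicyclic_b ^+ k = Bicyclic k 0.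
Proof.
elim: k => // k IHk; rewrite expgS IHk; case: k {IHk} => //= k.
Qed.

Lemma bicyclicE k l : Bicyclic k l = bicyclic_b ^+ k * bicyclic_a ^+ l.
Proof. by rewrite bicyclic_aX bicyclic_bX; case: l => [|l] /=; case: k. Qed.

Lemma bicyclic_univ (M : monoidType) (u v : M) : u * v = 1 ->
  exists! f : bicyclic -> M,
    [/\ monoid_morphism f, f bicyclic_a = u & f bicyclic_b = v].
Proof.
move=> uv1.
have uvX n : u ^+ n * v ^+ n = 1.
  elim: n => [|n IHn]; first by rewrite mulg1.
  by rewrite expgSr expgS mulgA -(mulgA _ u) uv1 mulg1.
exists (fun x => v ^+ bexp x * u ^+ aexp x); split.
  split; rewrite /= ?mul1g ?mulg1 //.
  split=> [|[k l] [m n]] /=; first by rewrite mulg1.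
  rewrite bicyclicM; case: (ltngtP l m) => [lm|ml|->] /=.
  - rewrite -[in v ^+ m](subnKC (ltnW lm)) !expgnDr !mulgA.
    by rewrite -(mulgA _ (u ^+ l)) uvX mulg1.
  - rewrite -[in u ^+ l](subnK (ltnW ml)) !expgnDr !mulgA.
    by rewrite -(mulgA _ (u ^+ m)) uvX mulg1.
  - by rewrite mulgA -(mulgA _ (u ^+ m)) uvX mulg1.
move=> g [[g1 gM] ga gb]; apply/funext => -[k l] /=.
have gX x n : g (x ^+ n) = g x ^+ n.
  by elim: n => // n IHn; rewrite !expgS gM IHn.
by rewrite bicyclicE gM !gX ga gb.
Qed.

(* A topology on the carrier of S is an element tau of [Topological S]; the
   corresponding space is [Topological.Pack tau], with carrier S. *)
Definition right_continuous (S : semigroupType) (tau : Topological S) : Prop :=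
  let X : topologicalType := Topological.Pack tau in
  forall s : S, continuous ((fun x : S => s * x) : X -> X).

Definition left_continuous (S : semigroupType) (tau : Topological S) : Prop :=
  let X : topologicalType := Topological.Pack tau in
  forall s : S, continuous ((fun x : S => x * s) : X -> X).

Definition baire_space (X : topologicalType) : Prop :=
  forall A : nat -> set X, (forall i, open (A i) /\ dense (A i)) ->
    dense (\bigcap_i A i).

Definition discrete_space (X : topologicalType) : Prop :=
  forall A : set X, open A.

(* Main.v *)
Require Import Defs.
From HB Require Import structures.
From mathcomp Require Import all_boot zify.
From mathcomp Require Import all_classical topology.

(**
  In a countable T1 Baire space every nonempty open set contains an isolated
  point.  If left translations are continuous and b^k a^n is isolated, then so
  is every b^m a^p with p <= n: the translation by b^k a^(n+m-p) sends b^m a^p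
  to b^k a^n, and the fibre of this translation over b^k a^n is finite.  So it
  suffices to find isolated points with n arbitrarily large.  The fixed points
  of the translation by ba are the b^m a^p with m > 0; they form a closed set,
  so {a^p | p > n} is open and contains an isolated point.  The case of right
  translations follows by the anti-automorphism exchanging a and b.
*)

Set Implicit Arguments.
Unset Strict Implicit.
Unset Printing Implicit Defensive.

Local Open Scope classical_set_scope.
Local Open Scope group_scope.

(** If no point of [U] were isolated, deleting the points of [U] one at a time would give countably
    many dense open sets whose intersection misses [U]. *)
Lemma open_baire_isolated (X : topologicalType) (U : set X) :
  accessible_space X -> countable [set: X] -> baire_space X ->
  open U -> U !=set0 -> exists2 x, U x & open [set x].
Proof.
move=> T1 /countable_injP[c cI] baireX oU U0.
apply: contrapT => noisol; pose A i := ~` (U `&` c @^-1` [set i]).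
have A_dense i : open (A i) /\ dense (A i).
  have sub1 x : (U `&` c @^-1` [set i]) x -> U `&` c @^-1` [set i] = [set x].
    move=> [Ux cx]; apply/seteqP; split=> [y [Uy cy]|y -> //].
    by apply: cI; rewrite ?inE //= cy.
  split.
    apply: closed_openC.
    have [->|/set0P[x /sub1 ->]] := eqVneq (U `&` c @^-1` [set i]) set0.
      exact: closed0.
    exact: accessible_closed_set1.
  (* An open [O] missing [A i] lies inside the single deleted point, which would then be
     isolated. *)
  move=> O [y Oy] oO; apply: contrapT => /nonemptyPn OA0.
  have OS : O `<=` U `&` c @^-1` [set i] by apply/subsets_disjoint.
  have := OS _ Oy => /sub1 E; apply: noisol; exists y; first by case: (OS _ Oy).
  suff -> : [set y] = O by [].
  by apply/seteqP; split=> [z -> //|z /OS]; rewrite E.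
have [x [Ux Ax]] := baireX A A_dense U U0 oU.
by apply: (Ax (c x)).
Qed.

(** Disjoint neighbourhoods [V] of [f x] and [U] of [x] make [U] meet the preimage of [V] in a
    neighbourhood of [x] without fixed points. *)
Lemma closed_fixpoints (X : topologicalType) (f : X -> X) :
  hausdorff_space X -> continuous f -> closed [set x | f x = x].
Proof.
rewrite open_hausdorff => hX cf; rewrite -openC openE => x /= /eqP /hX.
move=> [[V U] [/set_mem /= Vfx /set_mem /= Ux] [oV oU /eqP VU0]].
have nU : nbhs x U by apply: open_nbhs_nbhs.
have nV : nbhs x (f @^-1` V) by apply: cf; apply: open_nbhs_nbhs.
apply: filterS (filterI nU nV) => y [Uy Vfy] /= fy.
suff : (V `&` U) y by rewrite VU0.
by split=> //; rewrite -fy.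
Qed.

Section BicyclicTranslations.
(** The bijection [g] lets one argument serve both sides: it is the identity for left translations
    and the swap of exponents for right ones. *)
Variables (X : topologicalType) (g : X -> bicyclic) (h : bicyclic -> X).
Hypotheses (gK : cancel g h) (hK : cancel h g).
Hypothesis mul_cont : forall s, continuous (fun x => h (s * g x)).
Hypothesis hX : hausdorff_space X.

Let finite_closed (A : set X) : finite_set A -> closed A.
Proof. exact: (accessible_finite_set_closed.1 (hausdorff_accessible hX)). Qed.

Let finite_bounded (A : set X) N :
  (forall x, A x -> (bexp (g x) < N)%N /\ (aexp (g x) < N)%N) -> finite_set A.
Proof.
move=> AN; apply: (@sub_finite_set _ _
  ((bicyclic_pair \o g) @^-1` (`I_N `*` `I_N))) => //.
apply: finite_preimage; last by apply: finite_setX; apply: finite_II.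
move=> x y _ _ /(can_inj bicyclic_pairK); exact: (can_inj gK).
Qed.

Lemma open_set1_bicyclic_le k n m p : (p <= n)%N ->
  open [set h (Bicyclic k n)] -> open [set h (Bicyclic m p)].
Proof.
move=> pn ok; set j := (n + m - p)%N.
pose f x := h (Bicyclic k j * g x); pose F := f @^-1` [set h (Bicyclic k n)].
have oF : open F by apply: open_comp => // x _; apply: mul_cont.
have finF : finite_set F.
  (* A solution b^m' a^p' has m' <= j, since otherwise the exponent of b would exceed k; then j - m'
     + p' = n bounds p' by n. *)
  apply: (@finite_bounded _ (n + j).+1) => x /(can_inj hK).
  case: (g x) => m' p'; rewrite bicyclicM /=.
  by case: ifP => ?; [|case: ifP => ?] => -[]; lia.
have Fmp : F (h (Bicyclic m p)).
  rewrite /F /f /= hK bicyclicM; congr h.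
  by repeat case: ifP => ?; congr Bicyclic; lia.
(* The other points of the fibre form a finite, hence closed, set. *)
have -> : [set h (Bicyclic m p)] = F `&` ~` (F `\ h (Bicyclic m p)).
  apply/seteqP; split=> [x -> | x [Fx nx]]; first by split=> // -[_]; apply.
  by apply: contrapT => xn; apply: nx.
by apply: openI => //; exact: closed_openC (finite_closed (finite_setD _ finF)).
Qed.

Lemma bicyclic_discrete : baire_space X -> discrete_space X.
Proof.
move=> baireX.
have countX : countable [set: X].
  apply/countable_injP; exists (fun x => pickle (bicyclic_pair (g x))).
  move=> ? ? _ _ /(pcan_inj pickleK) /(can_inj bicyclic_pairK).
  exact: (can_inj gK).
have open1 (x : X) : open [set x].
  rewrite -(gK x); case: (g x) => m n.
  pose W := ~` [set x | h (bicyclic_b * bicyclic_a * g x) = x].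
  have oW : open W by apply: closed_openC; apply: closed_fixpoints.
  have WE y : W y <-> bexp (g y) = 0%N.
    rewrite /W /= -[X in _ = X](gK y); case: (g y) => k l.
    rewrite bicyclicM /=.
    split=> [wk|k0 /(can_inj hK)]; last first.
      by case: ifP => ?; [|case: ifP => ?] => -[]; lia.
    apply: contrapT => k0; apply: wk; congr h.
    by repeat case: ifP => ?; congr Bicyclic; lia.
  (* [V] consists of the a^p with p >= n. The removed set is finite because the exponent of b
     vanishes on [W]. *)
  pose V := W `&` ~` (W `&` [set y | (aexp (g y) < n)%N]).
  have [||y [Wy nVy] oy] := @open_baire_isolated _ V
      (hausdorff_accessible hX) countX baireX.
  - apply: openI => //; apply: closed_openC; apply: finite_closed.
    apply: (@finite_bounded _ n.+1) => y [/WE ->] /=; lia.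
  - exists (h (Bicyclic 0 n)); split; first by apply/WE; rewrite hK.
    by move=> [_] /=; rewrite hK /= ltnn.
  apply: (@open_set1_bicyclic_le (bexp (g y)) (aexp (g y))).
    by rewrite leqNgt; apply/negP => ?; apply: nVy.
  by have -> : Bicyclic (bexp (g y)) (aexp (g y)) = g y;
    [case: (g y) | rewrite gK].
move=> A; rewrite -[A]image_id -bigcup_imset1.
by apply: bigcup_open.
Qed.

End BicyclicTranslations.

Definition bicyclic_swap (x : bicyclic) := Bicyclic (aexp x) (bexp x).

Lemma bicyclic_swapK : involutive bicyclic_swap.
Proof. by case. Qed.

Lemma bicyclic_swapM x y :
  bicyclic_swap (x * y) = bicyclic_swap y * bicyclic_swap x.
Proof.
case: x y => [k l] [m n]; rewrite /bicyclic_swap !bicyclicM /=.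
by case: (ltngtP l m) => ? /=; congr Bicyclic; lia.
Qed.

Theorem theorem3 :
  (forall tau : Topological bicyclic,
     right_continuous tau ->
     hausdorff_space (Topological.Pack tau) ->
     baire_space (Topological.Pack tau) ->
     discrete_space (Topological.Pack tau)) /\
  (forall tau : Topological bicyclic,
     left_continuous tau ->
     hausdorff_space (Topological.Pack tau) ->
     baire_space (Topological.Pack tau) ->
     discrete_space (Topological.Pack tau)).
Proof.
split=> tau mul_cont hX.
  exact: (@bicyclic_discrete (Topological.Pack tau) id id).
apply: (@bicyclic_discrete (Topological.Pack tau) bicyclic_swap bicyclic_swap);
  [exact: bicyclic_swapK | exact: bicyclic_swapK | | by []].
move=> s.
(* Conjugation by the swap turns a left translation into a right one. *)
have -> : (fun x => bicyclic_swap (s * bicyclic_swap x)) = *%g^~ (bicyclic_swap s).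
  by apply/funext => x; rewrite bicyclic_swapM bicyclic_swapK.
exact: mul_cont.
Qed.
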